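(* Let $(J,\mathcal{B},\pi)$ be a standard Borel probability space, and for a $\mathcal{B}$-partition $\mathcal{P}$ of $J$ let $$\psi(\mathcal{P})=\mathsf{E}\Big(\frac{1}{|\mathcal{P}_{\mathbf{u}}|}\Big),$$ where $\mathbf{u}$ is a random point of $J$ with distribution $\pi$, $\mathcal{P}_u$ is the class of $\mathcal{P}$ containing $u$, and $1/|\mathcal{P}_u|=0$ if $\mathcal{P}_u$ is infinite. Let $\mathcal{P}$, $\mathcal{Q}$ and $\mathcal{R}$ be $\mathcal{B}$-partitions of $J$ with the re-randomizing property such that $\mathcal{R}\le\mathcal{P}$ and $\mathcal{R}\le\mathcal{Q}$. Then $$\psi(\mathcal{R})+\psi(\mathcal{P}\lor\mathcal{Q})\ge\psi(\mathcal{P})+\psi(\mathcal{Q}).$$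
   Context: For a partition $\mathcal{P}$ of $J$ and $X\subseteq J$, let $\mathcal{P}(X)=\bigcup\{P\in\mathcal{P}: P\cap X\ne\emptyset\}$. A partition $\mathcal{P}$ is a $\mathcal{B}$-partition if $\mathcal{P}(A)\in\mathcal{B}$ whenever $A\in\mathcal{B}$. For partitions, $\mathcal{R}\le\mathcal{P}$ means that $\mathcal{R}$ refines $\mathcal{P}$ (every class of $\mathcal{R}$ is contained in a class of $\mathcal{P}$), and $\mathcal{P}\lor\mathcal{Q}$ is the join in the partition lattice, i.e. the finest partition coarser than both $\mathcal{P}$ and $\mathcal{Q}$. Re-randomizing: let $\mathbf{u}$ be a random point from $\pi$. If $\mathcal{P}_{\mathbf{u}}$ is finite, let $\mathbf{v}$ be a uniform random point of $\mathcal{P}_{\mathbf{u}}$; else let $\mathbf{v}=\mathbf{u}$. The $\mathcal{B}$-partition $\mathcal{P}$ has the re-randomizing property (with respect to $\pi$) if $\mathbf{v}$ has distribution $\pi$. Equivalently, if $\mu_x$ is the uniform distribution on $\mathcal{P}_x$ when $\mathcal{P}_x$ is finite and $\mu_x=\delta_x$ otherwise, then $\int_J\mu_x(A)\,d\pi(x)=\pi(A)$ for all $A\in\mathcal{B}$. *)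

(* Defs.v *)
From HB Require Import structures.
From mathcomp Require Import all_boot all_order all_algebra finmap.
From mathcomp Require Import all_classical all_reals all_analysis.

Set Implicit Arguments.
Unset Strict Implicit.
Unset Printing Implicit Defensive.

Import Order.TTheory GRing.Theory Num.Theory.

Local Open Scope classical_set_scope.
Local Open Scope ring_scope.

(* A Polish space is given here with a choice of complete metric; completeness
   is the convergence of all Cauchy filters. *)
Definition polish (R : realType) (M : metricType R) : Prop :=
  (forall F : set_system M, ProperFilter F -> cauchy F -> exists x : M, F --> x)
  /\ (exists D : set M, countable D /\ dense D).

(* The sigma-algebra of J is the Borel sigma-algebra of a Polish topology,
   transported along a bijection f with the underlying space. *)
Definition standard_borel (R : realType) (d : measure_display)
    (J : measurableType d) : Prop :=
  exists (M : metricType R) (f : J -> M),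
    [/\ polish M, bijective f &
        forall B : set M, measurable (f @^-1` B) <-> <<s open >> B].

Section Partitions.
Variable J : Type.
Implicit Types (P Q S : set (set J)) (X : set J).

Definition is_partition P : Prop := partition P id [set: J].

Definition saturation P X : set J :=
  \bigcup_(C in [set C | P C /\ C `&` X !=set0]) C.

Definition pclass P (x : J) : set J := \bigcup_(C in [set C | P C /\ C x]) C.

Definition refines P Q : Prop :=
  forall C, P C -> exists2 D, Q D & C `<=` D.

(* Two points are in the same class of the join iff they are in the same class
   of every partition coarser than both P and Q; see pjoin_is_join. *)
Definition pjoin P Q : set (set J) :=
  [set \bigcap_(S in [set S | [/\ is_partition S, refines P S & refines Q S]])
         pclass S x | x in [set: J]].

Lemma pclass_self P x : is_partition P -> pclass P x x.
Proof.
move=> [cP _ _]; have [C PC Cx] : cover P id x by rewrite cP.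
by exists C.
Qed.

Lemma pclassE P C x : is_partition P -> P C -> C x -> pclass P x = C.
Proof.
move=> [_ tP _] PC Cx; apply/seteqP; split=> [y [D [PD Dx] Dy]|y Cy].
  suff -> : C = D by [].
  by apply: tP => //; exists x.
by exists C.
Qed.

Lemma pclass_eq P x y : is_partition P -> pclass P x y -> pclass P x = pclass P y.
Proof.
move=> hP [C [PC Cx] Cy].
by rewrite (pclassE hP PC Cx) (pclassE hP PC Cy).
Qed.

Lemma pclass_mem P x : is_partition P -> P (pclass P x).
Proof.
move=> hP; have [C [PC Cx] _] := pclass_self x hP.
by rewrite (pclassE hP PC Cx).
Qed.

Lemma pjoin_is_join P Q : is_partition P -> is_partition Q ->
  [/\ is_partition (pjoin P Q), refines P (pjoin P Q), refines Q (pjoin P Q) &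
      forall S, is_partition S -> refines P S -> refines Q S ->
        refines (pjoin P Q) S].
Proof.
move=> hP hQ.
have sub P' : is_partition P' ->
    (forall S, [/\ is_partition S, refines P S & refines Q S] ->
      refines P' S) -> refines P' (pjoin P Q).
  move=> [_ _ neP'] rP' C P'C; have [x Cx] := neP' C P'C.
  eexists; first by exists x.
  move=> y Cy S hS; have [D SD CD] := rP' S hS C P'C.
  by exists D; [split=> //; exact: CD | exact: CD].
split.
- split.
  + apply/seteqP; split=> // x _.
    exists (\bigcap_(S in [set S | [/\ is_partition S, refines P S &
      refines Q S]]) pclass S x); first by exists x.
    by move=> S [hS _ _]; exact: pclass_self.
  + move=> _ _ [x _ <-] [y _ <-] [z [xz yz]].
    apply: eq_bigcapr => S hS; have [pS _ _] := hS.
    by rewrite (pclass_eq pS (xz _ hS)) (pclass_eq pS (yz _ hS)).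
  + by move=> _ [x _ <-]; exists x => S [hS _ _]; exact: pclass_self.
- by apply: sub => // S [].
- by apply: sub => // S [].
- move=> S hS PS QS _ [x _ <-]; exists (pclass S x); first exact: pclass_mem.
  by apply: bigcap_inf; split.
Qed.

End Partitions.

Section Rerandomizing.
Context (R : realType) (d : measure_display) (J : measurableType d).
Implicit Types (P : set (set J)) (pr : probability J R).

Definition B_partition P : Prop :=
  is_partition P /\
  forall A : set J, measurable A -> measurable (saturation P A).

(* The measure mu_x: uniform on the class of x if that class is finite, the
   Dirac measure at x otherwise. *)
Definition class_unif P (x : J) (A : set J) : \bar R :=
  if `[< finite_set (pclass P x) >] then
    (#|` fset_set (pclass P x `&` A)|%:R / #|` fset_set (pclass P x)|%:R)%:E
  else \d_x A.

Definition rerandomizing pr P : Prop :=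
  forall A : set J, measurable A -> (\int[pr]_x class_unif P x A = pr A)%E.

Definition inv_card (X : set J) : R :=
  if `[< finite_set X >] then #|` fset_set X|%:R^-1 else 0.

Definition psi pr P : \bar R := ('E_pr[fun u => inv_card (pclass P u)])%E.

End Rerandomizing.

(* Main.v *)
(* Regard the classes of P and Q as the nodes, and the classes of a common
   refinement S as the edges, of a bipartite multigraph whose components are
   the classes of the join. Given a measurable set T, orient every edge towards
   T: every P-class and every Q-class in the saturation of T, except the
   P-classes meeting T, owns an edge leading closer to T, and no edge is owned
   twice. Rerandomizing along P and along Q turns this into
     int_V (1/|P_u| + 1/|Q_u|) <= int_V 1/|S_u| + pr T,
   where V is the saturation of T in the join. On an invariant set G all of
   whose join classes have at least k points there are k disjoint such sets T,
   so the last term improves to pr G / k. On the union G of the join classes of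
   size k this is int_G 1/|(P v Q)_u|; on the infinite ones k is arbitrary. *)
Require Import Defs.
From HB Require Import structures.
From mathcomp Require Import all_boot all_order all_algebra finmap.
From mathcomp Require Import all_classical all_reals all_analysis.
From mathcomp Require Import measurable_realfun.

Set Implicit Arguments.
Unset Strict Implicit.
Unset Printing Implicit Defensive.

Import Order.TTheory GRing.Theory Num.Theory.

Local Open Scope classical_set_scope.
Local Open Scope ring_scope.

(** * Invariant sets and the join of two partitions *)

Section Classes.
Variable J : Type.
Implicit Types (P Q S : set (set J)) (x y : J) (A V : set J).

Lemma pclass_sym P x y : is_partition P -> pclass P x y -> pclass P y x.
Proof. by move=> hP xy; rewrite -(pclass_eq hP xy); exact: pclass_self. Qed.

Lemma pclass_trans P y x z : is_partition P ->
  pclass P x y -> pclass P y z -> pclass P x z.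
Proof. by move=> hP xy; rewrite (pclass_eq hP xy). Qed.

Lemma refines_pclass P Q x : refines P Q -> pclass P x `<=` pclass Q x.
Proof.
move=> PQ y [C [PC Cx] Cy]; have [D QD CD] := PQ C PC.
by exists D; [split=> //; exact: CD|exact: CD].
Qed.

Lemma saturationP P A y : is_partition P ->
  saturation P A y <-> exists2 x, A x & pclass P x y.
Proof.
move=> hP; split=> [[C [PC [x [Cx Ax]]] Cy]|[x Ax [C [PC Cx] Cy]]].
  by exists x => //; exists C.
by exists C => //; split=> //; exists x.
Qed.

(** The invariant sets of [P], that is, the unions of its classes. *)
Definition pclosed P V := forall x y, pclass P x y -> V x -> V y.

Lemma subset_saturation P A : is_partition P -> A `<=` saturation P A.
Proof.
by move=> hP x Ax; apply/saturationP => //; exists x => //; exact: pclass_self.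
Qed.

Lemma pclosed_saturation P A : is_partition P -> pclosed P (saturation P A).
Proof.
move=> hP x y xy /(saturationP _ _ hP)[z Az zx].
by apply/saturationP => //; exists z => //; exact: pclass_trans xy.
Qed.

Lemma saturation_sub P A V : is_partition P ->
  A `<=` V -> pclosed P V -> saturation P A `<=` V.
Proof. by move=> hP AV hV x /(saturationP _ _ hP)[y /AV Vy /hV]; exact. Qed.

Lemma saturationS P A B : A `<=` B -> saturation P A `<=` saturation P B.
Proof.
by move=> AB x [C [PC [y [Cy /AB By]]] Cx]; exists C => //; split=> //; exists y.
Qed.

Lemma pclosed_refines P Q V : refines P Q -> pclosed Q V -> pclosed P V.
Proof. by move=> PQ hV x y /(refines_pclass PQ)/hV. Qed.

Lemma pclosedC P V : is_partition P -> pclosed P V -> pclosed P (~` V).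
Proof. by move=> hP hV x y xy nVx Vy; apply/nVx/(hV y) => //; exact: pclass_sym. Qed.

Lemma pclosedI P V W : pclosed P V -> pclosed P W -> pclosed P (V `&` W).
Proof. by move=> hV hW x y xy [/(hV _ _ xy) ? /(hW _ _ xy)]. Qed.

Lemma pclosedU P V W : pclosed P V -> pclosed P W -> pclosed P (V `|` W).
Proof. by move=> hV hW x y xy [/(hV _ _ xy)|/(hW _ _ xy)]; [left|right]. Qed.

Lemma pclosedD P V W : is_partition P ->
  pclosed P V -> pclosed P W -> pclosed P (V `\` W).
Proof. by move=> hP hV hW; apply: pclosedI => //; exact: pclosedC. Qed.

Lemma pclosed_bigcup P (F : nat -> set J) :
  (forall n, pclosed P (F n)) -> pclosed P (\bigcup_n F n).
Proof. by move=> hF x y xy [n _ /(hF n _ _ xy)]; exists n. Qed.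

(** The nonempty ones among [V] and its complement form a partition coarser than both [P] and [Q],
    so the join refines it. *)
Lemma pclosed_pjoin P Q V : is_partition P -> is_partition Q ->
  pclosed P V -> pclosed Q V -> pclosed (pjoin P Q) V.
Proof.
move=> hP hQ PV QV.
pose S := [set C | C !=set0 /\ (C = V \/ C = ~` V)].
have hS : is_partition S.
  split; last by move=> C [].
    apply/seteqP; split=> // x _; have [Vx|nVx] := pselect (V x).
      by exists V => //; split; [exists x|left].
    by exists (~` V) => //; split; [exists x|right].
  by move=> _ _ [_ [->|->]] [_ [->|->]] // [z [Vz /= nVz]].
have ref P' : is_partition P' -> pclosed P' V -> refines P' S.
  move=> hP' P'V C P'C; have [_ _ /(_ _ P'C)[x Cx]] := hP'.
  have [Vx|nVx] := pselect (V x).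
    exists V; first by split; [exists x|left].
    by move=> y Cy; apply: (P'V x) => //; exists C.
  exists (~` V); first by split; [exists x|right].
  by move=> y Cy; apply: (pclosedC hP' P'V (x := x)) => //; exists C.
have [_ _ _ /(_ S hS (ref P hP PV) (ref Q hQ QV)) JS] := pjoin_is_join hP hQ.
move=> x y /(refines_pclass JS) xy Vx.
have SV : S V by split; [exists x|left].
by rewrite (pclassE hS SV Vx) in xy.
Qed.

End Classes.

(** * Distance layers around [T] and the ownership of edges *)

Section Alternating.
Variables (J : Type) (P Q : set (set J)) (hP : is_partition P) (hQ : is_partition Q).
Variable T : set J.

(** In the bipartite graph of P- and Q-classes: the points whose P-class is at distance at most 2n
    from the P-classes meeting [T]. *)
Definition alt_sat n := iter n (saturation P \o saturation Q) (saturation P T).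

Lemma alt_sat_subQ n : alt_sat n `<=` saturation Q (alt_sat n).
Proof. exact: subset_saturation. Qed.

Lemma alt_sat_subS n : saturation Q (alt_sat n) `<=` alt_sat n.+1.
Proof. exact: subset_saturation. Qed.

Lemma alt_sat_mono m n : (m <= n)%N -> alt_sat m `<=` alt_sat n.
Proof.
move=> /subnK <-; elim: (n - m)%N => // k ih.
by apply: subset_trans ih _; apply: subset_trans (@alt_sat_subQ _) (@alt_sat_subS _).
Qed.

Lemma alt_sat_pclosed n : pclosed P (alt_sat n).
Proof. by case: n => [|n]; exact: pclosed_saturation. Qed.

(** The union is invariant under [P] and under [Q], hence under the join; conversely, no stage
    leaves a join-invariant set containing [T]. This countable description also makes the join a
    B-partition. *)
Lemma saturation_pjoin : saturation (pjoin P Q) T = \bigcup_n alt_sat n.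
Proof.
have [hj Pj Qj _] := pjoin_is_join hP hQ.
apply/seteqP; split.
  apply: saturation_sub => //.
    by move=> x Tx; exists 0%N => //; exact: subset_saturation.
  apply: pclosed_pjoin => //; first exact: (pclosed_bigcup alt_sat_pclosed).
  move=> x y xy [n _ nx]; exists n.+1 => //; apply: alt_sat_subS.
  by apply: (pclosed_saturation hQ xy); exact: alt_sat_subQ.
have cP := pclosed_refines Pj (pclosed_saturation (A := T) hj).
have cQ := pclosed_refines Qj (pclosed_saturation (A := T) hj).
move=> x [n _]; elim: n x => [|n ih].
  by apply: saturation_sub => //; exact: subset_saturation.
apply: saturation_sub => //; exact: saturation_sub.
Qed.

(** Edges whose Q-end is at distance 2n+1 and whose P-end is at distance 2n+2: the P-end is the
    farther one and owns the edge. *)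
Definition ownP := \bigcup_n (saturation Q (alt_sat n) `\` alt_sat n).

(** Edges whose Q-end is the farther one; the first term holds the edges at the P-classes of
    distance 0. *)
Definition ownQ := saturation P T `|`
  \bigcup_n (alt_sat n.+1 `\` saturation Q (alt_sat n)).

(** The sets [alt_sat n] and their Q-saturations form one increasing chain, and [ownP] and [ownQ]
    collect alternate layers of it. *)
Lemma own_disjoint : ownP `&` ownQ = set0.
Proof.
apply/seteqP; split=> // x [[n _ [nx nnx]]] [Tx|[m _ [mx nmx]]].
  by apply: nnx; exact: (alt_sat_mono (leq0n n)).
have [nm|mn] := leqP n m.
  by apply: nmx; apply: saturationS nx; exact: alt_sat_mono.
by apply: nnx; exact: (alt_sat_mono mn).
Qed.

Lemma own_sub : ownP `|` ownQ `<=` \bigcup_n alt_sat n.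
Proof.
move=> x [[n _ [/alt_sat_subS nx _]]|[Tx|[n _ [nx _]]]]; last by exists n.+1.
  by exists n.+1.
by exists 0%N.
Qed.

(** A P-class first reached at stage n+1 contains a point of the Q-saturation of stage n; as stage n
    is P-invariant, that point lies outside it and is owned. *)
Lemma alt_sat_ownP :
  (\bigcup_n alt_sat n) `\` saturation P T `<=` saturation P ownP.
Proof.
move=> x [[n _ nx] nTx].
elim: n nx => // n ih nx.
have [/ih//|nnx] := pselect (alt_sat n x).
have /(saturationP _ _ hP)[y ny yx] := nx.
apply/saturationP => //; exists y => //; exists n => //; split=> // nny.
exact/nnx/(alt_sat_pclosed yx).
Qed.

Lemma alt_sat_ownQ : \bigcup_n alt_sat n `<=` saturation Q ownQ.
Proof.
move=> x [n _] /alt_sat_subQ; elim: n => [|n ih] nx.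
  have /(saturationP _ _ hQ)[y ny yx] := nx.
  by apply/saturationP => //; exists y => //; left.
have [/ih//|nnx] := pselect (saturation Q (alt_sat n) x).
have /(saturationP _ _ hQ)[y ny yx] := nx.
apply/saturationP => //; exists y => //; right; exists n => //; split=> // nny.
exact/nnx/(pclosed_saturation hQ yx).
Qed.

(** Ownership depends only on the P-class and the Q-class of a point, and these are constant on a
    class of [S]. *)
Lemma own_pclosed S : is_partition S -> refines S P -> refines S Q ->
  pclosed S ownP /\ pclosed S ownQ.
Proof.
move=> hS SP SQ.
have cP n : pclosed S (alt_sat n).
  by apply: pclosed_refines SP _; exact: alt_sat_pclosed.
have cQ n : pclosed S (saturation Q (alt_sat n)).
  by apply: pclosed_refines SQ _; exact: pclosed_saturation.
split; first by apply: pclosed_bigcup => n; exact: pclosedD.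
apply: pclosedU; first exact: (cP 0%N).
by apply: pclosed_bigcup => n; exact: pclosedD.
Qed.

End Alternating.

(** * Countable families separating points *)

(** The sets are the interiors of the balls of radius 1/(j+1) about a countable dense set, pulled
    back along [f]. *)
Lemma standard_borel_separating (R : realType) (d : measure_display)
    (J : measurableType d) : standard_borel R J ->
  exists E : nat -> set J, (forall n, measurable (E n)) /\
    forall x y, x <> y -> exists n, E n x /\ ~ E n y.
Proof.
move=> [M [f [[_ [D [/countable_injP[g ginj] Ddense]]] /bij_inj finj fB]]].
pose r j : R := j.+1%:R^-1.
(* [g] is injective on [D], so this union has at most one term: [i] is the code of the centre. *)
pose B i j := \bigcup_(c in [set c | D c /\ g c = i]) (ball c (r j))°.
exists (fun n => if @choice.unpickle (nat * nat)%type n is Some (i, j)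
  then f @^-1` B i j else set0).
split=> [n|x y xy].
  case: (choice.unpickle n) => [[i j]|] //; apply/fB; apply: sub_sigma_algebra.
  by apply: bigcup_open => c _; exact: open_interior.
have e0 : 0 < mdist (f x) (f y).
  rewrite lt_neqAle mdist_ge0 andbT eq_sym; apply/eqP => /mdist_positivity.
  by move/finj.
have [j rj] : exists j, r j < mdist (f x) (f y) / 2.
  have e2 : 0 < mdist (f x) (f y) / 2 by rewrite divr_gt0.
  have [j _ /(_ j (leqnn j))] := near_infty_natSinv_lt (PosNum e2).
  by exists j.
have r0 : 0 < r j by rewrite invr_gt0.
(* With the centre [c] within r_j/2 of [f x], the ball of radius r_j/2 about [f x] lies in the one
   of radius r_j about [c], so [f x] is interior to the latter. If [f y] were in it too, the
   distance from [f x] to [f y] would be below 3r_j/2. *)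
have [c [xc Dc]] : (ball (f x) (r j / 2))° `&` D !=set0.
  apply: Ddense; last exact: open_interior.
  by exists (f x); apply: nbhsx_ballx; rewrite divr_gt0.
move: xc => /interior_subset xc.
exists (choice.pickle (g c, j)); rewrite choice.pickleK; split.
  exists c => //; apply: filterS (nbhsx_ballx (f x) (r j / 2) _).
    move=> z xz; rewrite [r j]splitr; apply: ball_triangle xz; exact: ball_sym.
  by rewrite divr_gt0.
move=> [c' [Dc' gc']]; rewrite (ginj _ _ _ _ gc') ?inE //.
move=> /interior_subset cy; have := ball_triangle xc cy.
rewrite ballEmdist /=; apply/negP; rewrite -leNgt.
rewrite [leRHS]splitr lerD // ltW // (lt_trans _ rj) // ltr_pdivrMr//.
by rewrite ltr_pMr // ltr1n.
Qed.

Definition separated (J : choiceType) (k : nat) (U : nat -> set J) (A : set J) :=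
  forall i, (i < k)%N -> A `&` U i !=set0.

(** Each [U n] is coded by a depth m and a list of distinct itineraries, the itinerary [g m x]
    recording which of the first m sets [E i] contain [x]. The points of a finite [B] have distinct
    itineraries at some depth, and listing them gives the family for [B]. *)
Lemma separating_families (d : measure_display) (J : measurableType d)
    (E : nat -> set J) :
  (forall n, measurable (E n)) ->
  (forall x y, x <> y -> exists n, E n x /\ ~ E n y) ->
  exists U : nat -> nat -> set J,
    [/\ forall n i, measurable (U n i),
        forall n, trivIset setT (U n) &
        forall B : {fset J}, exists n, separated #|` B| (U n) [set` B]].
Proof.
move=> mE sepE.
pose g m x := [seq `[< E i x >] | i <- iota 0 m].
have mg m c : measurable [set x | g m x = c].
  have -> : [set x | g m x = c] = if size c == m then
      \bigcap_(i in `I_m) (if nth false c i then E i else ~` E i) else set0.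
    case: eqP => [sc|nsc]; last first.
      apply/seteqP; split=> // x /= gx.
      by apply: nsc; rewrite -gx size_map size_iota.
    apply/seteqP; split=> [x /= <- i im|x /= cx].
      rewrite (nth_map 0%N) ?size_iota// nth_iota//= add0n.
      by case: asboolP.
    apply: (@eq_from_nth _ false); rewrite size_map size_iota// => i im.
    rewrite (nth_map 0%N) ?size_iota// nth_iota//= add0n.
    by have := cx i im; case: ifP => [_ ?|_ ?]; [apply/asboolT|apply/asboolF].
  case: ifP => // _; apply: bigcap_measurableType => i _.
  by case: ifP => _; [exact: mE|exact: measurableC].
have gmono m n x y : (m <= n)%N -> g n x = g n y -> g m x = g m y.
  move=> mn gxy; apply: (@eq_from_nth _ false); rewrite !size_map// => i.
  rewrite size_iota => im; have := congr1 (nth false ^~ i) gxy.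
  have i_n := leq_trans im mn.
  by rewrite !(nth_map 0%N) ?size_iota// !nth_iota.
have gsep x y : x <> y -> exists m, g m x <> g m y.
  move=> /sepE[n [nx nny]]; exists n.+1 => /(congr1 (nth false ^~ n)).
  rewrite !(nth_map 0%N) ?size_iota// nth_iota// add0n.
  by rewrite asboolT// asboolF.
have gsepB (s : seq J) : exists m, {in s &, injective (g m)}.
  elim: s => [|x s [m ih]]; first by exists 0%N.
  have [m' hm'] : exists m', forall y, y \in s -> g m' x = g m' y -> x = y.
    elim: s {ih} => [|y s [m1 ih]]; first by exists 0%N.
    have [<-|/eqP/gsep[m2 xy]] := eqVneq x y.
      by exists m1 => z; rewrite inE => /orP[/eqP->//|/ih].
    exists (maxn m1 m2) => z; rewrite inE => /orP[/eqP->|zs].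
      by move=> /(gmono m2 _ _ _ (leq_maxr _ _)).
    by move=> /(gmono m1 _ _ _ (leq_maxl _ _))/(ih _ zs).
  exists (maxn m m') => y z.
  have g1 := gmono m _ _ _ (leq_maxl m m').
  have g2 := gmono m' _ _ _ (leq_maxr m m').
  rewrite !inE => /orP[/eqP->|ys] /orP[/eqP->|zs] //.
  - by move=> /g2/(hm' _ zs).
  - by move=> /esym/g2/(hm' _ ys) ->.
  - by move=> /g1; exact: ih.
pose U n i : set J :=
  if @choice.unpickle (nat * seq (seq bool))%type n is Some (m, c) then
  if uniq c && (i < size c)%N then [set x | g m x = nth [::] c i] else set0
  else set0.
exists U; split.
- by move=> n i; rewrite /U; case: (choice.unpickle n) => [[m c]|]//; case: ifP.
- move=> n i j _ _ [x []]; rewrite /U; case: (choice.unpickle n) => [[m c]|]//.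
  case: ifP => // /andP[uc ic]; case: ifP => // /andP[_ jc] /= -> /eqP.
  by rewrite nth_uniq// => /eqP.
- move=> B; have [m ginj] := gsepB B.
  exists (choice.pickle (m, [seq g m x | x <- B])) => i iB.
  rewrite /U choice.pickleK map_inj_in_uniq// fset_uniq size_map iB /=.
  have [x0 _] : exists x0, x0 \in B.
    by apply/fset0Pn; rewrite -cardfs_gt0; exact: leq_ltn_trans iB.
  exists (nth x0 B i); split; first by rewrite /= mem_nth.
  by rewrite /= (nth_map x0).
Qed.

(** * Class sizes as measurable functions *)

Lemma fset_set_infinite (J : choiceType) (A : set J) :
  ~ finite_set A -> fset_set A = fset0.
Proof. by rewrite /fset_set; case: pselect. Qed.

(** The finiteness premise makes an infinite set qualify for every [k]; its [fset_set] is empty. *)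
Definition at_least (J : choiceType) (k : nat) (A : set J) :=
  finite_set A -> (k <= #|` fset_set A|)%N.

Lemma separated_at_least (J : choiceType) k (U : nat -> set J) A :
  trivIset setT U -> separated k U A -> at_least k A.
Proof.
move=> tU sA fA.
have /choice[f hf] : forall i : 'I_k, exists x, (A `&` U i) x.
  by move=> i; have [x] := sA i (ltn_ord i); exists x.
have finj : injective f.
  move=> i j fij; apply/val_inj/tU => //; exists (f i).
  split; first by have [] := hf i.
  by rewrite fij; have [] := hf j.
rewrite -[leqLHS](size_enum_ord k) -(size_map f); apply: uniq_leq_size.
  by rewrite map_inj_uniq// enum_uniq.
move=> _ /mapP[i _ ->]; rewrite in_fset_set// inE.
by have [] := hf i.
Qed.

(** A family separating a [k]-point subset also separates [A]. The countable existential over [n] is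
    what makes conditions on class sizes measurable. *)
Lemma at_leastP (J : choiceType) (U : nat -> nat -> set J) k A :
  (forall n, trivIset setT (U n)) ->
  (forall B : {fset J}, exists n, separated #|` B| (U n) [set` B]) ->
  at_least k A <-> exists n, separated k (U n) A.
Proof.
move=> tU sepU; split=> [kA|[n]]; last exact: separated_at_least.
have [B BA kB] : exists2 B : {fset J}, [set` B] `<=` A & (k <= #|` B|)%N.
  have [fA|iA] := pselect (finite_set A); last exact: infinite_set_fset.
  by exists (fset_set A); [rewrite fset_setK|exact: kA].
have [n sB] := sepU B; exists n => i ik.
have [x [Bx Ux]] := sB i (leq_trans ik kB).
by exists x; split=> //; exact: BA.
Qed.

(** An infinite intersection counts 0. For [A = setT] the value 0 thus means an infinite class, and
    [0^-1 = 0] agrees with the convention on 1/|P_u|. *)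
Definition npt (J : choiceType) (P : set (set J)) (A : set J) (x : J) :=
  #|` fset_set (pclass P x `&` A)|.

Lemma npt_gt0 (J : choiceType) (P : set (set J)) x : is_partition P ->
  (0 < npt P setT x)%N = `[< finite_set (pclass P x) >].
Proof.
move=> hP; rewrite /npt setIT; apply/idP/asboolP => [|fx].
  by apply: contraPP => /fset_set_infinite ->.
rewrite cardfs_gt0; apply/fset0Pn; exists x.
by rewrite in_fset_set// inE; exact: pclass_self.
Qed.

Lemma inv_card_npt (R : realType) (d : measure_display) (J : measurableType d)
    (P : set (set J)) x :
  inv_card R (pclass P x) = (npt P setT x)%:R^-1.
Proof.
rewrite /inv_card /npt setIT; case: asboolP => // /fset_set_infinite ->.
by rewrite cardfs0 invr0.
Qed.

Lemma class_unif_ge0 (R : realType) (d : measure_display) (J : measurableType d)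
    (P : set (set J)) x (A : set J) : (0 <= class_unif R P x A)%E.
Proof.
by rewrite /class_unif; case: asboolP => //= _; rewrite lee_fin divr_ge0.
Qed.

Section Counting.
Context (R : realType) (d : measure_display) (J : measurableType d).
Variables (U : nat -> nat -> set J).
Hypothesis mU : forall n i, measurable (U n i).
Hypothesis tU : forall n, trivIset setT (U n).
Hypothesis sepU : forall B : {fset J}, exists n, separated #|` B| (U n) [set` B].
Variable P : set (set J).
Hypothesis bP : B_partition P.
Let hP : is_partition P. Proof. by case: bP. Qed.

(** The class of [x] meets a set exactly when [x] lies in its saturation, which is measurable for a
    B-partition. *)
Lemma measurable_separated k A n : measurable A ->
  measurable [set x | separated k (U n) (pclass P x `&` A)].
Proof.
move=> mA.
rewrite (_ : [set _ | _] = \bigcap_(i in `I_k) saturation P (A `&` U n i)).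
  by apply: bigcap_measurableType => i _; apply: bP.2; exact: measurableI.
apply/seteqP; split=> x xs i ik.
  have [y [[xy Ay] Uy]] := xs i ik.
  by apply/saturationP => //; exists y => //; exact: pclass_sym.
have /(saturationP _ _ hP)[y [Ay Uy] yx] := xs i ik.
by exists y; split=> //; split=> //; exact: pclass_sym.
Qed.

Lemma measurable_at_least k A : measurable A ->
  measurable [set x | at_least k (pclass P x `&` A)].
Proof.
move=> mA.
rewrite (_ : [set _ | _] =
    \bigcup_n [set x | separated k (U n) (pclass P x `&` A)]).
  by apply: bigcupT_measurable => n; exact: measurable_separated.
apply/seteqP; split=> x /=.
  by move=> /(at_leastP _ _ tU sepU)[n]; exists n.
by move=> [n _ xn]; apply/(at_leastP _ _ tU sepU); exists n.
Qed.

Lemma npt_fibre A j : measurable A -> measurable [set x | npt P A x = j].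
Proof.
move=> mA.
have pos i : measurable [set x | npt P A x = i.+1].
  rewrite (_ : [set _ | _] = [set x | at_least i.+1 (pclass P x `&` A)] `\`
      [set x | at_least i.+2 (pclass P x `&` A)]).
    by apply: measurableD; exact: measurable_at_least.
  apply/seteqP; split=> x /=; rewrite /npt.
    have [fx|ix] := pselect (finite_set (pclass P x `&` A)); last first.
      by rewrite fset_set_infinite.
    by move=> xi; split=> [_|/(_ fx)]; rewrite xi// ltnn.
  move=> [x1 x2]; have fx : finite_set (pclass P x `&` A).
    by apply: contrapT => ix; apply: x2 => /ix.
  apply/eqP; rewrite eqn_leq x1// andbT -ltnS ltnNge.
  by apply/negP => x3; apply: x2.
case: j => //.
(* The value 0 mixes empty and infinite intersections, so its fibre is taken as the complement of
   the others. *)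
rewrite (_ : [set _ | _] = ~` \bigcup_i [set x | npt P A x = i.+1]).
  by apply: measurableC; exact: bigcupT_measurable.
apply/seteqP; split=> x /=; first by move=> x0 [n _ /=]; rewrite x0.
by case E: (npt P A x) => [//|n] nx; case: nx; exists n.
Qed.

Lemma measurable_npt A : measurable A ->
  measurable_fun [set: J] (npt P A).
Proof.
move=> mA _ Y _; rewrite setTI.
rewrite (_ : _ @^-1` _ = \bigcup_(j in Y) [set x | npt P A x = j]).
  by apply: bigcup_measurable => j _; exact: npt_fibre.
apply/seteqP; split=> [x Yx|x [j Yj /= xj]]; last by rewrite /= xj.
by exists (npt P A x).
Qed.

Lemma measurable_comp_npt (h : nat -> R) A : measurable A ->
  measurable_fun [set: J] (fun x => h (npt P A x)).
Proof. by move=> mA; apply: measurableT_comp => //; exact: measurable_npt. Qed.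

Lemma measurable_inv_card :
  measurable_fun [set: J] (fun x => inv_card R (pclass P x)).
Proof.
under eq_fun do rewrite inv_card_npt.
exact: (measurable_comp_npt (fun n => n%:R^-1)).
Qed.

(** One formula for both cases: on an infinite class the quotient has denominator 0 and vanishes,
    leaving the Dirac term; on a finite class the indicator vanishes. *)
Lemma class_unifE x A : class_unif R P x A =
  ((npt P A x)%:R / (npt P setT x)%:R
   + \1_(A `&` [set y | npt P setT y = 0%N]) x)%:E.
Proof.
rewrite /class_unif indicE; have := npt_gt0 x hP; case: asboolP => fx x0.
  rewrite memNset ?addr0; last by move=> [_ /= x0']; rewrite x0' in x0.
  by rewrite /npt setIT.
have {}x0 : npt P setT x = 0%N by apply/eqP; rewrite -leqn0 leqNgt x0.
rewrite x0 invr0 mulr0 add0r diracE; congr (_%:R%:E).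
by rewrite in_setI [X in _ && X]mem_set// andbT.
Qed.

Lemma measurable_class_unif A : measurable A ->
  measurable_fun [set: J] (fun x => class_unif R P x A).
Proof.
move=> mA; under eq_fun do rewrite class_unifE.
apply/measurable_EFinP/measurable_funD.
  apply: measurable_funM.
    exact: (measurable_comp_npt (fun n => n%:R)).
  exact: (measurable_comp_npt (fun n => n%:R^-1)).
by apply: measurable_indic; apply: measurableI => //; exact: npt_fibre.
Qed.

End Counting.

(** * Mass transport by rerandomizing *)

Section Transport.
Context (R : realType) (d : measure_display) (J : measurableType d).
Variables (pr : probability J R) (U : nat -> nat -> set J).
Hypothesis mU : forall n i, measurable (U n i).
Hypothesis tU : forall n, trivIset setT (U n).
Hypothesis sepU : forall B : {fset J}, exists n, separated #|` B| (U n) [set` B].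
Implicit Types (P Q S : set (set J)) (A B O H T : set J).

Definition class_integral P A : \bar R :=
  \int[pr]_(x in A) (inv_card R (pclass P x))%:E.

Lemma measurable_EFin_inv_card P A : B_partition P ->
  measurable_fun A (fun x => (inv_card R (pclass P x))%:E).
Proof.
move=> bP; apply: measurable_funTS; apply/measurable_EFinP.
exact: (@measurable_inv_card R _ _ _ mU tU sepU P bP).
Qed.

Lemma inv_card_ge0 A : 0 <= inv_card R A.
Proof. by rewrite /inv_card; case: asboolP. Qed.

Lemma class_unif_ge P x A B : finite_set (pclass P x) ->
  B `<=` pclass P x `&` A ->
  ((#|` fset_set B|%:R * inv_card R (pclass P x))%:E <= class_unif R P x A)%E.
Proof.
move=> fx BA; rewrite /class_unif /inv_card; case: asboolP => // _.
have fA : finite_set (pclass P x `&` A) by exact: finite_setIl.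
rewrite lee_fin ler_wpM2r// ler_nat fsubset_leq_card// -fset_set_sub//.
exact: sub_finite_set fA.
Qed.

Lemma inv_card_le_class_unif P x A y : is_partition P ->
  pclass P x y -> A y ->
  ((inv_card R (pclass P x))%:E <= class_unif R P x A)%E.
Proof.
move=> hP xy Ay; have [fx|ix] := pselect (finite_set (pclass P x)); last first.
  by rewrite /inv_card asboolF// class_unif_ge0.
have : [set y] `<=` pclass P x `&` A by move=> _ ->.
by move=> /(class_unif_ge fx); rewrite fset_set1 cardfs1 mul1r.
Qed.

(** If the class of [x] is finite and meets [T], then mu_x gives [T] mass at least 1/|P_x|;
    integrating mu_x over all [x] returns [pr T]. *)
Lemma class_integral_saturation P T : B_partition P -> rerandomizing pr P ->
  measurable T -> (class_integral P (saturation P T) <= pr T)%E.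
Proof.
move=> bP rP mT; have hP := bP.1; rewrite -(rP T mT).
have mcu := @measurable_class_unif R _ _ _ mU tU sepU P bP _ mT.
apply: (@le_trans _ _ (\int[pr]_(x in saturation P T) class_unif R P x T)%E).
  apply: ge0_le_integral => //.
  - exact: bP.2.
  - by move=> x _; rewrite lee_fin inv_card_ge0.
  - exact: measurable_EFin_inv_card.
  - exact: measurable_funTS.
  - move=> x /(saturationP _ _ hP)[y Ty yx].
    by apply: inv_card_le_class_unif Ty => //; exact: pclass_sym.
apply: ge0_subset_integral => //; first exact: bP.2.
by move=> x _; exact: class_unif_ge0.
Qed.

(* Rerandomizing 1/|S_x| restricted to O along P: a finite class of P that
   meets O contains a whole class of S inside O, whose points have total
   weight 1. *)
Lemma class_integral_le P S O H : B_partition P -> rerandomizing pr P ->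
  B_partition S -> refines S P -> measurable O -> pclosed S O ->
  measurable H -> H `<=` saturation P O ->
  (class_integral P H <= class_integral S O)%E.
Proof.
move=> bP rP bS SP mO cO mH HO; have hP := bP.1; have hS := bS.1.
(* Slicing [O] by the size of the S-class makes 1/|S_x| constant on each slice, so rerandomizing
   applies slice by slice. The slice 0 of infinite classes has weight 0. *)
pose N := npt S setT; pose Ok k := O `&` [set x | N x = k].
have mOk k : measurable (Ok k).
  by apply: measurableI => //; exact (npt_fibre mU tU sepU bS k (@measurableT _ J)).
have OE : O = \bigcup_k Ok k.
  by apply/seteqP; split=> [x Ox|x [k _ []]//]; exists (N x).
have mcu k := @measurable_class_unif R _ _ _ mU tU sepU P bP _ (mOk k).
have cu0 k x : (0 <= (k%:R^-1)%:E * class_unif R P x (Ok k))%E.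
  by rewrite mule_ge0// ?lee_fin//; exact: class_unif_ge0.
have mterm k : measurable_fun [set: J]
    (fun x => ((k%:R^-1)%:E * class_unif R P x (Ok k))%E).
  exact: measurable_funeM.
(* The integral of 1/|S_z| over [O] against mu_x, as a series over the slices. *)
pose F x : \bar R := (\sum_(0 <= k <oo) (k%:R^-1)%:E * class_unif R P x (Ok k))%E.
have mF : measurable_fun [set: J] F.
  exact: (@ge0_emeasurable_sum _ _ _ _ _ xpredT).
have -> : class_integral S O = (\int[pr]_x F x)%E.
  rewrite integral_nneseries// /class_integral {1}OE.
  rewrite ge0_integral_bigcup//; last 3 first.
  - exact: measurable_EFin_inv_card.
  - by move=> x _; rewrite lee_fin inv_card_ge0.
  - by move=> i j _ _ [x [[_ /= <-] [_ /= <-]]].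
  apply: eq_eseriesr => k _.
  rewrite ge0_integralZl_EFin//; last by move=> x _; exact: class_unif_ge0.
  rewrite (rP _ (mOk k)) -(integral_cst pr (mOk k)).
  apply: eq_integral => x; rewrite inE => -[_ /= xk].
  by rewrite inv_card_npt -/N xk.
apply: (@le_trans _ _ (\int[pr]_(x in H) F x)%E); last first.
  apply: ge0_subset_integral => // x _.
  by apply: nneseries_ge0 => k _ _; exact: cu0.
apply: ge0_le_integral => //.
- by move=> x _; rewrite lee_fin inv_card_ge0.
- exact: measurable_EFin_inv_card.
- exact: measurable_funTS.
move=> x /HO/(saturationP _ _ hP)[y Oy yx].
have [fx|ix] := pselect (finite_set (pclass P x)); last first.
  rewrite /inv_card asboolF//.
  by apply: nneseries_ge0 => k _ _; exact: cu0.
have sub : pclass S y `<=` pclass P x.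
  move=> z /(refines_pclass SP) yz; apply: pclass_trans yz => //.
  exact: pclass_sym.
have fy : finite_set (pclass S y) by exact: sub_finite_set fx.
have Ny : (0 < N y)%N by rewrite npt_gt0//; exact/asboolP.
have subO : pclass S y `<=` pclass P x `&` Ok (N y).
  move=> z yz; split; first exact: sub.
  by split; [exact: cO yz Oy|rewrite /N /npt /= (pclass_eq hS yz)].
(* One term of the series suffices: the [N y] points of the S-class of [y] have weight 1/[N y] and
   mu_x-mass 1/|P_x| each. *)
apply: (@le_trans _ _ ((N y)%:R^-1%:E * class_unif R P x (Ok (N y)))%E).
  have -> : (inv_card R (pclass P x))%:E =
      ((N y)%:R^-1%:E * ((N y)%:R * inv_card R (pclass P x))%:E)%E.
    by rewrite -EFinM mulKf// pnatr_eq0 -lt0n.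
  apply: lee_wpmul2l; first by rewrite lee_fin.
  by have := class_unif_ge fx subO; rewrite /N /npt setIT.
apply: le_trans (nneseries_lim_ge (N y).+1 _); last by move=> k _ _; exact: cu0.
rewrite big_nat_recr//= leeDr//; apply: sume_ge0 => k _; exact: cu0.
Qed.

End Transport.

(** * The inequality on invariant sets of the join *)

Section JoinInequality.
Context (R : realType) (d : measure_display) (J : measurableType d).
Variables (pr : probability J R) (U : nat -> nat -> set J).
Hypothesis mU : forall n i, measurable (U n i).
Hypothesis tU : forall n, trivIset setT (U n).
Hypothesis sepU : forall B : {fset J}, exists n, separated #|` B| (U n) [set` B].
Implicit Types (P Q S : set (set J)) (A G T : set J).

Lemma measurable_alt_sat P Q T n : B_partition P -> B_partition Q ->
  measurable T -> measurable (alt_sat P Q T n).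
Proof.
move=> bP bQ mT; elim: n => [|n ih]; first exact: bP.2.
exact/bP.2/bQ.2.
Qed.

Lemma B_partition_pjoin P Q : B_partition P -> B_partition Q ->
  B_partition (pjoin P Q).
Proof.
move=> bP bQ; split; first by have [] := pjoin_is_join bP.1 bQ.1.
move=> A mA; rewrite (saturation_pjoin bP.1 bQ.1).
by apply: bigcupT_measurable => n; exact: measurable_alt_sat.
Qed.

Lemma class_integralU P A B : B_partition P -> measurable A -> measurable B ->
  A `&` B = set0 ->
  (class_integral pr P (A `|` B) = class_integral pr P A + class_integral pr P B)%E.
Proof.
move=> bP mA mB AB; apply: ge0_integral_setU => //.
- exact: (@measurable_EFin_inv_card _ _ _ _ mU tU sepU).
- by move=> x _; rewrite lee_fin inv_card_ge0.
- exact/disj_set2P.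
Qed.

Lemma class_integral_subset P A B : B_partition P -> measurable A -> measurable B ->
  A `<=` B -> (class_integral pr P A <= class_integral pr P B)%E.
Proof.
move=> bP mA mB AB; apply: ge0_subset_integral => //.
- exact: (@measurable_EFin_inv_card _ _ _ _ mU tU sepU).
- by move=> x _; rewrite lee_fin inv_card_ge0.
Qed.

(** The P-classes meeting [T] cost at most [pr T]; the other P-classes are charged to [ownP] and all
    Q-classes to [ownQ], which are disjoint inside [V]. *)
Lemma class_integral_saturation_pjoin P Q S T :
  B_partition P -> B_partition Q -> B_partition S ->
  rerandomizing pr P -> rerandomizing pr Q -> refines S P -> refines S Q ->
  measurable T -> let V := saturation (pjoin P Q) T in
  (class_integral pr P V + class_integral pr Q V <= class_integral pr S V + pr T)%E.
Proof.
move=> bP bQ bS rP rQ SP SQ mT; have [hP hQ hS] := And3 bP.1 bQ.1 bS.1.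
have malt n := measurable_alt_sat n bP bQ mT.
rewrite /= (saturation_pjoin hP hQ); set V := \bigcup_n _.
have mV : measurable V by exact: bigcupT_measurable.
have mP0 : measurable (saturation P T) by exact: bP.2.
have mownP : measurable (ownP P Q T).
  by apply: bigcupT_measurable => n; apply: measurableD => //; exact: bQ.2.
have mownQ : measurable (ownQ P Q T).
  apply: measurableU => //; apply: bigcupT_measurable => n.
  by apply: measurableD => //; exact: bQ.2.
have [cP cQ] := own_pclosed hP hQ T hS SP SQ.
have VE : V = saturation P T `|` (V `\` saturation P T).
  by rewrite setDUK// => x Tx; exists 0%N.
rewrite {1}VE class_integralU//; last 2 first.
- exact: measurableD.
- by apply/seteqP; split=> // x [? []].
have IP := class_integral_le mU tU sepU bP rP bS SP mownP cP
  (measurableD mV mP0) (@alt_sat_ownP _ P Q hP T).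
have IQ := class_integral_le mU tU sepU bQ rQ bS SQ mownQ cQ
  mV (@alt_sat_ownQ _ P Q hQ T).
have IT := class_integral_saturation mU tU sepU bP rP mT.
apply: le_trans (leeD (leeD IT IP) IQ) _.
rewrite -addeA addeC leeD2r// -class_integralU//; last exact: own_disjoint.
apply: class_integral_subset => //; first exact: measurableU.
exact: own_sub.
Qed.

(* The i-th set consists of the points lying in the i-th member of the first
   family U n that meets their class in k places. *)
Lemma disjoint_transversals P k : B_partition P ->
  exists T : nat -> set J, [/\ forall i, measurable (T i), trivIset setT T &
    forall x, at_least k (pclass P x) -> separated k T (pclass P x)].
Proof.
move=> bP; have hP := bP.1.
pose F n := [set x | separated k (U n) (pclass P x)].
have mF n : measurable (F n).
  rewrite (_ : F n = [set x | separated k (U n) (pclass P x `&` setT)]).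
    exact: measurable_separated.
  by apply/seteqP; split=> x; rewrite /F /= setIT.
(* By invariance all points of a class receive the same first index [n]. *)
have cF n : pclosed P (seqDU F n).
  move=> x y xy; have FE m : F m x = F m y by rewrite /F /= (pclass_eq hP xy).
  rewrite /seqDU -bigcup_mkord => -[nx nm]; split; first by rewrite -FE.
  by apply: contra_not nm => -[m mn my]; exists m; rewrite // FE.
exists (fun i => \bigcup_n (seqDU F n `&` U n i)); split.
- move=> i; apply: bigcupT_measurable => n; apply: measurableI => //.
  exact: seqDU_measurable.
- move=> i j _ _ [x [[n _ [nx ni]] [m _ [mx mj]]]].
  have nm : n = m by apply: (trivIset_seqDU F) => //; exists x.
  by rewrite -{}nm in mj; apply: (tU (n := n)) => //; exists x.
- move=> x /(at_leastP _ _ tU sepU)[n nx] i ik.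
  have : (\bigcup_n F n) x by exists n.
  rewrite seqDU_bigcup_eq => -[m _ mx].
  have [y [xy Uy]] := mx.1 i ik.
  by exists y; split=> //; exists m => //; split=> //; exact: cF xy mx.
Qed.

Lemma class_integral_fin_num P A : B_partition P -> measurable A ->
  class_integral pr P A \is a fin_num.
Proof.
move=> bP mA; rewrite ge0_fin_numE; last first.
  by apply: integral_ge0 => x _; rewrite lee_fin inv_card_ge0.
apply: (@le_lt_trans _ _ (\int[pr]_(x in A) cst 1 x)%E).
  apply: ge0_le_integral => //.
  - by move=> x _; rewrite lee_fin inv_card_ge0.
  - exact: (@measurable_EFin_inv_card _ _ _ _ mU tU sepU).
  - move=> x _; rewrite lee_fin inv_card_npt.
    by case: (npt _ _ _) => [|n]; rewrite ?invr0// invf_le1// ler1n.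
rewrite integral_cst// mul1e; apply: le_lt_trans (ltry 1).
exact: probability_le1.
Qed.

(** Each of k+1 disjoint transversals, cut down to [G], has join-saturation [G]. Their inequalities
    are averaged, and their masses add up to at most [pr G]. *)
Lemma class_integral_at_least P Q S G k :
  B_partition P -> B_partition Q -> B_partition S ->
  rerandomizing pr P -> rerandomizing pr Q -> refines S P -> refines S Q ->
  measurable G -> pclosed (pjoin P Q) G ->
  (forall x, G x -> at_least k.+1 (pclass (pjoin P Q) x)) ->
  (class_integral pr P G + class_integral pr Q G <=
   class_integral pr S G + (k.+1%:R^-1)%:E * pr G)%E.
Proof.
move=> bP bQ bS rP rQ SP SQ mG cG Gk.
have bC := B_partition_pjoin bP bQ; have hC := bC.1.
have [T [mT tT hT]] := disjoint_transversals k.+1 bC.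
have step i : (i < k.+1)%N -> (class_integral pr P G + class_integral pr Q G <=
    class_integral pr S G + pr (T i `&` G))%E.
  move=> ik; have := class_integral_saturation_pjoin bP bQ bS rP rQ SP SQ
    (measurableI _ _ (mT i) mG).
  rewrite /= (_ : saturation _ _ = G)//; apply/seteqP; split.
    by apply: saturation_sub => //; exact: subIsetr.
  move=> x Gx; have [y [xy Ty]] := hT x (Gk x Gx) i ik.
  apply/saturationP => //; exists y; last exact: pclass_sym.
  by split=> //; exact: cG xy Gx.
have mTG i : measurable (T i `&` G) by exact: measurableI.
have finG A : measurable A -> pr A \is a fin_num by exact: fin_num_measure.
move: step.
rewrite -(fineK (class_integral_fin_num bP mG)).
rewrite -(fineK (class_integral_fin_num bQ mG)).
rewrite -(fineK (class_integral_fin_num bS mG)).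
set a := fine _; set b := fine _; set c := fine _ => step.
have {}step i : (i < k.+1)%N -> a + b <= c + fine (pr (T i `&` G)).
  by move=> /step; rewrite -(fineK (finG _ (mTG i))) -!EFinD lee_fin.
have sumT : \sum_(i < k.+1) fine (pr (T i `&` G)) <= fine (pr G).
  rewrite -lee_fin -sumEFin (fineK (finG _ mG)).
  under eq_bigr => i _ do rewrite (fineK (finG _ (mTG i))).
  rewrite -measure_bigsetU_ord.
  - rewrite le_measure ?inE//; first exact: bigsetU_measurable.
    elim/big_ind: _ => [//|A B AG BG|i _]; last exact: subIsetr.
    by rewrite subUset.
  - by move=> i; exact: mTG.
  - by move=> i j _ _ [x [[ix _] [jx _]]]; apply/val_inj/tT => //; exists x.
rewrite -(fineK (finG _ mG)) -EFinM -!EFinD lee_fin.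
have : \sum_(i < k.+1) (a + b) <= \sum_(i < k.+1) (c + fine (pr (T i `&` G))).
  by apply: ler_sum => i _; exact: step.
rewrite [leRHS]big_split/= !sumr_const card_ord -[(a + b) *+ _]mulr_natl.
rewrite -[c *+ _]mulr_natl => h.
have {sumT}h := le_trans h (lerD (lexx _) sumT).
have k0 : (0 : R) < k.+1%:R by rewrite ltr0n.
rewrite -(ler_pM2l k0) [leRHS]mulrDr mulVKf ?gt_eqF//.
Qed.

Lemma class_integral_fibre P Q S j
    (G := [set x | npt (pjoin P Q) setT x = j]) :
  B_partition P -> B_partition Q -> B_partition S ->
  rerandomizing pr P -> rerandomizing pr Q -> refines S P -> refines S Q ->
  (class_integral pr P G + class_integral pr Q G <=
   class_integral pr S G + class_integral pr (pjoin P Q) G)%E.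
Proof.
move=> bP bQ bS rP rQ SP SQ.
have bC := B_partition_pjoin bP bQ; have hC := bC.1.
have mG : measurable G := npt_fibre mU tU sepU bC j measurableT.
have cG : pclosed (pjoin P Q) G.
  by move=> x y xy; rewrite /G /npt /= (pclass_eq hC xy).
have -> : class_integral pr (pjoin P Q) G = ((j%:R^-1)%:E * pr G)%E.
  rewrite -(integral_cst pr mG); apply: eq_integral => x; rewrite inE => xj.
  by rewrite inv_card_npt xj.
(* For a positive size the averaged error is exactly the join integral over [G]. *)
case: j @G mG cG => [|j] G mG cG; last first.
  apply: class_integral_at_least => // x xj _.
  by rewrite -[pclass _ _]setIT -/(npt _ _ _) xj.
(* Size 0 is the fibre of the infinite join classes: they are [at_least] of every size, so the error
   1/(k+1) can be brought below any [e]. *)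
rewrite invr0 mul0e adde0; apply/lee_addgt0Pr => e e0.
have [k _ /(_ k (leqnn k)) ke] := near_infty_natSinv_lt (PosNum e0).
apply: (@le_trans _ _ (class_integral pr S G + (k.+1%:R^-1)%:E * pr G)%E).
  apply: class_integral_at_least => // x x0 fx.
  by have /asboolP := fx; rewrite -npt_gt0// x0.
rewrite leeD2l// (@le_trans _ _ (k.+1%:R^-1)%:E)//; last by rewrite lee_fin ltW.
by rewrite -[leRHS]mule1 lee_wpmul2l ?lee_fin// probability_le1.
Qed.

End JoinInequality.

Theorem lemma3p1 (R : realType) (d : measure_display) (J : measurableType d)
    (pr : probability J R) (hJ : standard_borel R J)
    (PP QQ RR : set (set J))
    (hP : B_partition PP) (hQ : B_partition QQ) (hR : B_partition RR)
    (rP : rerandomizing pr PP) (rQ : rerandomizing pr QQ)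
    (rR : rerandomizing pr RR)
    (RP : refines RR PP) (RQ : refines RR QQ) :
  (psi pr RR + psi pr (pjoin PP QQ) >= psi pr PP + psi pr QQ)%E.
Proof.
have [E [mE /(separating_families mE)[U [mU tU sepU]]]] :=
  standard_borel_separating hJ.
have bC := B_partition_pjoin hP hQ.
(* The fibres of the join class size, with 0 for infinite classes, partition [J]; every [psi] splits
   along them. *)
pose G j := [set x | npt (pjoin PP QQ) setT x = j].
have mG j : measurable (G j) := npt_fibre mU tU sepU bC j measurableT.
have int_ge0 P A : (0 <= class_integral pr P A)%E.
  by apply: integral_ge0 => x _; rewrite lee_fin inv_card_ge0.
have psiE P : B_partition P ->
    psi pr P = (\sum_(0 <= j <oo) class_integral pr P (G j))%E.
  move=> bP; rewrite /psi unlock -ge0_integral_bigcup//.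
  - congr integral; apply/esym/seteqP; split=> // x _.
    by exists (npt (pjoin PP QQ) setT x).
  - exact: (@measurable_EFin_inv_card _ _ _ _ mU tU sepU).
  - by move=> x _; rewrite lee_fin inv_card_ge0.
  - by move=> i j _ _ [x [/= <- <-]].
have sumD P Q : (\sum_(0 <= j <oo) class_integral pr P (G j) +
    \sum_(0 <= j <oo) class_integral pr Q (G j) =
    \sum_(0 <= j <oo) (class_integral pr P (G j) + class_integral pr Q (G j)))%E.
  by rewrite nneseriesD.
rewrite (psiE _ hP) (psiE _ hQ) (psiE _ hR) (psiE _ bC) !sumD.
apply: lee_nneseries => [j _ _|j _]; first exact: adde_ge0.
exact: class_integral_fibre.
Qed.
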